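(* Let $C$ be any concept class over a domain $X$ with $|C|\geq 2$. Every proper or improper $\epsilon$-differentially private $(\alpha,\beta=\tfrac12)$-PAC $k$-learner for $C$ requires sample complexity $\Omega(k/\epsilon)$.
   Context: A $k$-labeled database of size $n$ is an element of $(X\times\{0,1\}^k)^n$. An algorithm $\mathcal A$ taking such a database and outputting $k$ hypotheses $h_1,\dots,h_k:X\to\{0,1\}$ is an $(\alpha,\beta)$-PAC $k$-learner for $C$ with sample complexity $n$ if for every distribution $\mathcal D$ over $X$ and every $c_1,\dots,c_k\in C$, given $S=((x_i,c_1(x_i),\dots,c_k(x_i)))_{i=1}^n$ with $x_i$ i.i.d. from $\mathcal D$, $\Pr[\max_j\Pr_{x\sim\mathcal D}[h_j(x)\neq c_j(x)]>\alpha]\leq\beta$. It is proper if the hypotheses always lie in $C$. Two databases of the same size are neighboring if they differ in one entry; $\epsilon$-differential privacy means $\Pr[\mathcal A(S)\in T]\le e^\epsilon\Pr[\mathcal A(S')\in T]$ for all neighboring $S,S'$ and all output sets $T$. *)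

(* Defs.v *)
From HB Require Import structures.
From mathcomp Require Import all_boot all_order all_algebra.
From mathcomp Require Import all_classical all_reals all_analysis.

Set Implicit Arguments.
Unset Strict Implicit.
Unset Printing Implicit Defensive.

Import Order.TTheory GRing.Theory Num.Theory.
Import numFieldNormedType.Exports.

Local Open Scope classical_set_scope.
Local Open Scope ring_scope.
Local Open Scope ereal_scope.

(* Concepts and hypotheses are the measurable maps X -> {0,1}, so that their
   errors are defined; over a discrete domain these are all maps X -> {0,1}. *)
Definition concept d (X : measurableType d) : Type := {mfun X >-> bool}.

HB.instance Definition _ d (X : measurableType d) :=
  Choice.on (concept X).
HB.instance Definition _ d (X : measurableType d) :=
  isPointed.Build (concept X) (cst false : {mfun X >-> bool}).

Definition error d (X : measurableType d) (R : realType)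
    (D : probability X R) (c h : concept X) : \bar R :=
  D [set x | h x != c x].

(* The coarsest sigma-algebra for which all the errors are measurable functions
   of the hypothesis. A kernel for any finer sigma-algebra is also a kernel for
   this one, and its privacy and accuracy carry over. *)
Definition error_events d (X : measurableType d) (R : realType) :
    set_system (concept X) :=
  [set E | exists (D : probability X R) (c : concept X) (r : R),
     E = [set h | r%:E < error D c h]].

Definition hypothesis d (X : measurableType d) (R : realType) :=
  g_sigma_algebraType (@error_events d X R).

Section iid.
Context d (X : measurableType d) (R : realType) (D : probability X R).

Definition tuple_cons n (p : X * n.-tuple X) : n.+1.-tuple X :=
  [tuple of p.1 :: p.2].

Lemma measurable_tuple_cons n : measurable_fun setT (@tuple_cons n).
Proof. exact: measurable_cons. Qed.

HB.instance Definition _ n := isMeasurableFun.Build _ _ _ _ (@tuple_cons n)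
  (@measurable_tuple_cons n).

Fixpoint iid n : probability (n.-tuple X) R :=
  match n with
  | 0 => \d_([tuple] : 0.-tuple X)
  | n'.+1 => distribution (D \x iid n') (@tuple_cons n')
  end.

End iid.

Definition database d (X : measurableType d) (k n : nat) :=
  n.-tuple (X * k.-tuple bool).

(* Differential privacy only depends on the law of the output for each database,
   so a randomized algorithm is a probability kernel. *)
Definition algorithm d (X : measurableType d) (R : realType) (k n : nat) :=
  R.-pker (database X k n) ~> (k.-tuple (hypothesis X R)).

Definition label d (X : measurableType d) (k n : nat)
    (c : k.-tuple (concept X)) (xs : n.-tuple X) : database X k n :=
  [tuple (tnth xs i, [tuple tnth c j (tnth xs i) | j < k]) | i < n].

Definition pac_learner d (X : measurableType d) (R : realType) (k n : nat)
    (alpha beta : R) (C : set (concept X)) (A : algorithm X R k n) : Prop :=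
  forall (D : probability X R) (c : k.-tuple (concept X)),
    (forall j, C (tnth c j)) ->
    \int[iid D n]_xs A (label c xs)
      [set h | alpha%:E < \big[maxe/-oo]_(j < k) error D (tnth c j) (tnth h j)]
    <= beta%:E.

Definition neighbors T n (S S' : n.-tuple T) : Prop :=
  exists i, tnth S i <> tnth S' i /\
    forall j, j != i -> tnth S j = tnth S' j.

Definition differentially_private d (X : measurableType d) (R : realType)
    (k n : nat) (eps : R) (A : algorithm X R k n) : Prop :=
  forall S S' : database X k n, neighbors S S' ->
  forall T, measurable T -> A S T <= (expR eps)%:E * A S' T.

(* Main.v *)
Require Import Defs.
From HB Require Import structures.
From mathcomp Require Import all_boot all_order all_algebra.
From mathcomp Require Import all_classical all_reals all_analysis.
From mathcomp Require Import measurable_realfun lra.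
Import Order.TTheory GRing.Theory Num.Theory.

(* Fix a point x separating two concepts and let the data distribution be the
   Dirac mass at x. The 2^k labelings of x give 2^k databases, and with
   probability at least 1/2 the learner recovers the labeling of its database.
   These success events are disjoint, and by group privacy each of them has
   probability at least exp(-eps n)/2 on one common database, so that
   2^(k-1) <= exp(eps n). *)

Local Open Scope classical_set_scope.
Local Open Scope ring_scope.

(** A product of Dirac masses agrees with the Dirac mass at the pair on measurable rectangles, so
    uniqueness of the product measure carries the induction on [n]. *)
Lemma iid_dirac d (X : measurableType d) (R : realType) (x : X) n
    (A : set (n.-tuple X)) :
  measurable A ->
  iid (\d_x : probability X R) n A = \d_([tuple x | _ < n]) A.
Proof.
elim: n A => [|n IH] A mA /=.
  by rewrite [in RHS]tuple0.
have mA' : measurable (@tuple_cons d X n @^-1` A).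
  by rewrite -[X in measurable X]setTI; exact: measurable_tuple_cons.
rewrite /distribution /pushforward.
rewrite (@product_measure_unique _ _ _ _ _ _ _
  (\d_(x, [tuple x | _ < n]) : {measure set (X * n.-tuple X) -> \bar R}))//.
  suff xE : tuple_cons (x, [tuple x | _ < n]) = [tuple x | _ < n.+1].
    rewrite !diracE; congr (_%:R%:E)%E; congr nat_of_bool.
    by apply/idP/idP; rewrite !inE/= xE.
  apply/eq_from_tnth => i; rewrite tnth_mktuple.
  case: (unliftP ord0 i) => [j ->|->]; last by rewrite tnth0.
  by rewrite tnthS tnth_mktuple.
move=> B C mB mC; rewrite [X in (_ * X)%E](IH C mC) !diracE.
rewrite -EFinM -natrM mulnb; congr (_%:R%:E)%E; congr nat_of_bool.
by apply/idP/andP; rewrite !inE.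
Qed.

(** Turns the averaged failure probability in [pac_learner] into the failure probability on one
    constant sample. *)
Lemma integral_iid_dirac d (X : measurableType d) (R : realType) (x : X) n
    (f : n.-tuple X -> \bar R) :
  measurable_fun [set: n.-tuple X] f ->
  (\int[iid (\d_x : probability X R) n]_xs f xs = f [tuple x | _ < n])%E.
Proof.
move=> mf.
rewrite (eq_measure_integral
  (\d_([tuple x | _ < n]) : {measure set (n.-tuple X) -> \bar R})).
  by rewrite integral_dirac// diracT mul1e.
by move=> A mA _; exact: iid_dirac.
Qed.

Lemma group_privacy d (X : measurableType d) (R : realType) k n (eps : R)
    (A : algorithm X R k n) (S S' : database X k n) T :
  0 <= eps -> differentially_private eps A -> measurable T ->
  (A S T <= (expR (eps * n%:R))%:E * A S' T)%E.
Proof.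
move=> eps0 dpA mT.
(* Hybrids lead from [S] to [S'] by replacing one entry at a time, each replacement costing a factor
   of at most [expR eps]. *)
pose hyb i : database X k n :=
  [tuple if (j < i)%N then tnth S' j else tnth S j | j < n].
suff H i : (i <= n)%N -> (A S T <= (expR (eps * i%:R))%:E * A (hyb i) T)%E.
  have := H n (leqnn n); congr (_ <= _ * A _ T)%E.
  by apply/eq_from_tnth => j; rewrite tnth_mktuple ltn_ord.
elim: i => [_|i IH ltin].
  rewrite mulr0 expR0 mul1e le_eqVlt; apply/orP; left; apply/eqP.
  by congr (A _ T); apply/eq_from_tnth => j; rewrite tnth_mktuple ltn0.
apply: (le_trans (IH (ltnW ltin))).
rewrite -natr1 mulrDr mulr1 expRD EFinM -muleA.
apply: lee_wpmul2l; first by rewrite lee_fin expR_ge0.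
have hybE j : j != Ordinal ltin -> tnth (hyb i) j = tnth (hyb i.+1) j.
  move=> ji; rewrite !tnth_mktuple ltnS [(j <= i)%N]leq_eqVlt.
  by rewrite -[i in (_ == i)]/(nat_of_ord (Ordinal ltin)) val_eqE (negbTE ji).
(* [neighbors] demands a genuine change of entry. If the entries agree, the two hybrids coincide and
   [0 <= eps] gives the bound. *)
have [eqi|neqi] := pselect (tnth (hyb i) (Ordinal ltin) =
                            tnth (hyb i.+1) (Ordinal ltin)).
  have -> : hyb i = hyb i.+1.
    apply/eq_from_tnth => j.
    by have [->|/hybE] := eqVneq j (Ordinal ltin).
  rewrite -[leLHS]mul1e lee_wpmul2r// lee_fin.
  by rewrite -expR0 ler_expR.
by apply: dpA => //; exists (Ordinal ltin).
Qed.

Lemma measurable_label d (X : measurableType d) k n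
    (c : k.-tuple (concept X)) :
  measurable_fun [set: n.-tuple X] (@label d X k n c).
Proof.
apply/measurable_fun_tnthP => i.
rewrite (_ : _ \o _ = fun xs => (tnth xs i,
   [tuple tnth c j (tnth xs i) | j < k])); last first.
  by apply/funext => xs /=; rewrite tnth_mktuple.
apply/measurable_fun_pair => /=; first exact: measurable_tnth.
apply/measurable_fun_tnthP => j.
rewrite (_ : _ \o _ = fun xs => tnth c j (tnth xs i)); last first.
  by apply/funext => xs /=; rewrite tnth_mktuple.
apply: (measurableT_comp (measurable_funP (tnth c j))).
exact: measurable_tnth.
Qed.

(** The maximum exceeds [alpha] exactly when some coordinate's error does, and each such event comes
    from a generator of the sigma-algebra on [hypothesis]. *)
Lemma measurable_failure d (X : measurableType d) (R : realType) k (alpha : R)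
    (D : probability X R) (c : k.-tuple (concept X)) :
  measurable [set h : k.-tuple (hypothesis X R) |
    alpha%:E < \big[maxe/-oo]_(j < k) error D (tnth c j) (tnth h j)]%E.
Proof.
rewrite (_ : [set _ | _] = \bigcup_(j in [set: 'I_k])
    (fun h : k.-tuple (hypothesis X R) => tnth h j) @^-1`
      [set h | alpha%:E < error D (tnth c j) h]%E); last first.
  apply/seteqP; split=> h /=.
    rewrite ltNge => /bigmax_leP/not_andP[]; first by rewrite leNye.
    move=> /existsNP[j /not_implyP[_ /negP]]; rewrite -ltNge => jh.
    by exists j.
  by move=> [j _ jh]; apply: (lt_le_trans jh); exact: le_bigmax.
apply: fin_bigcup_measurable => [|j _]; first exact: finite_finset.
rewrite -[X in measurable X]setTI; apply: measurable_tnth => //; apply: sub_sigma_algebra.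
by exists D, (tnth c j), alpha.
Qed.

Lemma separated_concepts d (X : measurableType d) (C : set (concept X)) :
  (`I_2 #<= C)%card ->
  exists (x : X) (c : bool -> concept X), forall b, C (c b) /\ c b x = b.
Proof.
move=> /pcard_leP[f].
have f01 : f 0%N <> f 1%N by move=> /inj; rewrite !inE => /(_ isT isT).
have [x fx] : exists x, f 0%N x <> f 1%N x.
  by apply/existsNP => fE; apply: f01; apply/mfuneqP.
(* The two concepts take both boolean values at [x], so they can be indexed by their value there. *)
exists x, (fun b => if f 0%N x == b then f 0%N else f 1%N) => b.
case: eqP => [<-|fb]; split=> //; try exact: funS.
by move: fx fb; case: (f 0%N x); case: (f 1%N x); case: b.
Qed.

Section packing.
Context d (X : measurableType d) (R : realType) (k n : nat) (alpha eps : R).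
Context (C : set (concept X)) (A : algorithm X R k n).
Context (x : X) (c : bool -> concept X).
Hypotheses (alpha1 : alpha < 1).
Hypotheses (cC : forall b, C (c b)) (cx : forall b, c b x = b).

Let target (y : k.-tuple bool) := [tuple c (tnth y j) | j < k].

Let S y : database X k n := label (target y) [tuple x | _ < n].

Let bad y := [set h : k.-tuple (hypothesis X R) |
  alpha%:E < \big[maxe/-oo]_(j < k)
    error (\d_x : probability X R) (tnth (target y) j) (tnth h j)]%E.

Let good y := ~` bad y.

Let measurable_bad y : measurable (bad y).
Proof. exact: measurable_failure. Qed.

Let measurable_good y : measurable (good y).
Proof. exact: measurableC. Qed.

(** Under the Dirac mass at [x] every error is 0 or 1, so an error at most [alpha < 1] must
    vanish. *)
Let good_eval y h : good y h -> forall j, (tnth h j : concept X) x = tnth y j.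
Proof.
rewrite /good/= => /negP; rewrite -leNgt => /bigmax_leP[_ H] j.
have := H j isT; rewrite tnth_mktuple /error/= diracE lee_fin => ja.
apply/eqP; apply: contraTT ja => hy.
by rewrite mem_set/= ?cx// -ltNge.
Qed.

Let trivIset_good : trivIset setT good.
Proof.
move=> y z _ _ [h [/good_eval hy /good_eval hz]].
by apply/eq_from_tnth => j; rewrite -hy -hz.
Qed.

Let half_le_good y : pac_learner alpha (1 / 2) C A ->
  ((1 / 2)%:E <= A (S y) (good y))%E.
Proof.
move=> /(_ (\d_x) (target y)).
rewrite integral_iid_dirac; last first.
  apply: (measurableT_comp (measurable_kernel A _ _)).
    exact: measurable_failure.
  exact: measurable_label.
move=> /(_ _)/wrap[j|]; first by rewrite tnth_mktuple.
rewrite -/(S y) -/(bad y) => failS.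
have : (A (S y) (bad y) + A (S y) (good y) = 1)%E.
  by rewrite -measureU ?setICr// setUv; exact: prob_kernel.
move: (A _ _) (A _ _) failS => [a||] [b||] //=.
rewrite -EFinD !lee_fin => aP [] abP; lra.
Qed.

Lemma exp_labels_le : 0 <= eps -> differentially_private eps A ->
  pac_learner alpha (1 / 2) C A -> 2 ^+ k <= 2 * expR (eps * n%:R).
Proof.
move=> eps0 dpA pacA.
(* Any fixed labeling could serve as the common reference. *)
pose y0 := [tuple false | _ < k].
pose G (i : 'I_#|{: k.-tuple bool}|) := good (enum_val i).
(* Success probability 1/2, divided by the group privacy cost of changing all [n] entries. *)
pose p : R := (2 * expR (eps * n%:R))^-1.
have p0 : 0 < p by rewrite invr_gt0 mulr_gt0// expR_gt0.
have pG i : (p%:E <= A (S y0) (G i))%E.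
  rewrite /p invfM EFinM muleC lee_pdivrMl ?expR_gt0//.
  apply: le_trans (group_privacy _ _ _ _ _ _ _ (S (enum_val i)) _ _ eps0 dpA _);
    last exact: measurable_good.
  by rewrite -div1r; exact: half_le_good.
have mG i : measurable (G i) by exact: measurable_good.
have trivG : trivIset setT G.
  by move=> i j _ _ H; apply: enum_val_inj; apply: trivIset_good H.
have : (\sum_(i < #|{: k.-tuple bool}|) p%:E <= 1)%E.
  rewrite -(@prob_kernel _ _ _ _ _ A (S y0)).
  apply: (@le_trans _ _ (A (S y0) (\big[setU/set0]_i G i))).
    by rewrite measure_bigsetU_ord//; apply: lee_sum => i _; exact: pG.
  apply: le_measure => //; rewrite inE; last exact: measurableT.
  by apply: bigsetU_measurable => i _; exact: mG.
rewrite sumEFin lee_fin sumr_const card_ord card_tuple card_bool.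
by rewrite -[p *+ _]mulr_natl natrX ler_pdivrMr ?mul1r// mulr_gt0// expR_gt0.
Qed.

End packing.

(* For k = 1 no such bound holds: if #|C| = 2, a uniformly random element of C,
   output without looking at any sample, fails with probability at most 1/2. *)
Theorem theorem5p1 (R : realType) :
  exists a : R, 0 < a /\
  forall (d : measure_display) (X : measurableType d) (C : set (concept X)),
    (`I_2 #<= C)%card ->
  forall (k n : nat) (alpha eps : R),
    (2 <= k)%N -> alpha < 1 -> 0 < eps ->
  forall A : algorithm X R k n,
    differentially_private eps A ->
    pac_learner alpha (1 / 2) C A ->
    a * (k%:R / eps) <= n%:R.
Proof.
(* [ln 2] comes from taking logarithms of the packing bound, and the half from [k - 1 >= k / 2]. *)
exists (ln 2 / 2); split; first by rewrite divr_gt0// ln_gt0// ltr1n.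
move=> d X C /separated_concepts[x [c cP]] k n alpha eps k2 alpha1 eps0.
move=> A dpA pacA.
have pow_le : 2 ^+ k <= 2 * expR (eps * n%:R).
  exact: (exp_labels_le _ _ _ _ _ _ _ _ _ _ _ alpha1 (fun b => (cP b).1)
    (fun b => (cP b).2) (ltW eps0) dpA pacA).
(* The factor 2 due to success probability 1/2 cancels one of the [k] factors, leaving [k.-1]. *)
have log_le : k.-1%:R * ln 2 <= eps * n%:R.
  rewrite mulr_natl -lnXn// -[leRHS]expRK ler_ln ?posrE ?exprn_gt0 ?expR_gt0//.
  by rewrite -(@ler_pM2l _ 2)// -exprS prednK// ltnW.
rewrite mulrA ler_pdivrMr// [leRHS]mulrC (le_trans _ log_le)//.
rewrite -mulrA [leRHS]mulrC ler_pM2l ?ln_gt0 ?ltr1n//.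
(* What remains is [k <= 2 * k.-1], where [2 <= k] enters. *)
rewrite ler_pdivrMl// -natrM ler_nat.
by case: k k2 {A dpA pacA pow_le log_le} => [|[|k]]// _;
  rewrite mul2n -addnn/= addSn !ltnS leq_addl.
Qed.
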